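(* Let $(d_n)_{n\ge 0}$ be the real sequence defined by $d_0=-1$ and, for $n\ge 1$, $$d_n=\frac{1}{n}\sum_{k=0}^{n-1}\frac{n-k}{12^{\,n-k+1}}\left(\frac{(-1)^{n-k}\,11-11^{\,n-k+1}}{n-k}-\frac{(-1)^{n-k-1}-11^{\,n-k+1}}{n-k+1}\right)d_k .$$ Then for every positive integer $m$, $$\left(1+\frac{1}{m}\right)^{m}=e\left(1-\sum_{n=1}^{\infty}\frac{d_n}{\left(m+\frac{11}{12}\right)^{n}}\right).$$
   Context: $e$ is the base of the natural logarithm. *)

(* Defs.v *)
From Stdlib Require Import Reals.
From Coquelicot Require Import Coquelicot.
Open Scope R_scope.

(* The recursion is used only for n >= 1, so that [pred n] is n - 1 and every
   [n - k] with k <= n - 1 is an honest positive integer. *)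
Definition is_d_sequence (d : nat -> R) : Prop :=
  d 0%nat = -1 /\
  forall n : nat, (1 <= n)%nat ->
    d n = 1 / INR n *
      sum_n (fun k : nat =>
        INR (n - k) / 12 ^ (n - k + 1) *
        (((-1) ^ (n - k) * 11 - 11 ^ (n - k + 1)) / INR (n - k)
         - ((-1) ^ (n - k - 1) - 11 ^ (n - k + 1)) / INR (n - k + 1)) * d k)
      (pred n).

(* Main.v *)
(** Put x = m + 11/12 and t = 1/x, so that m ln (1 + 1/m) =
    (1/t - 11/12) (ln (1 + t/12) - ln (1 - 11 t/12)) =: E t.
    E is a power series with E 0 = 1, and the recursion for d says exactly that
    D t = \sum_n d_n t^n solves D' = E' D, D 0 = -1; hence D t = - exp (E t - 1).
    The coefficients of E' are bounded by 1, so by induction those of D are too,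
    and everything converges on |t| < 1, whereas t <= 12/23. *)
Require Import Defs.
From Stdlib Require Import Reals Lra Lia.
From Coquelicot Require Import Coquelicot.
Open Scope R_scope.

Lemma CV_radius_of_bounded (a : nat -> R) (M x : R) :
  (forall n, Rabs (a n) <= M) -> Rabs x < 1 ->
  Rbar_lt (Rabs x) (CV_radius a).
Proof.
  intros Ha Hx.
  apply Rbar_lt_le_trans with 1; [exact Hx|].
  apply (proj1 (CV_radius_bounded a)).
  exists M; intros n.
  rewrite pow1, Rmult_1_r; apply Ha.
Qed.

Lemma is_derive_zero_const (f : R -> R) (b t : R) :
  (forall s, Rabs s < b -> is_derive f s 0) -> Rabs t < b -> f t = f 0.
Proof.
  intros Hf Ht.
  apply Rabs_def2 in Ht.
  destruct (Rtotal_order t 0) as [H|[->|H]]; [|reflexivity|symmetry];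
    apply (eq_is_derive f); try exact H;
    intros s Hs; apply Hf, Rabs_def1; lra.
Qed.

(** Integrating factor: [Hode] makes the derivative of [PSeries a s * exp (- PSeries c s)] vanish on
    the unit interval, so this product keeps its value at 0. Boundedness of the coefficients gives
    the convergence needed to differentiate termwise and to form the Cauchy product. *)
Lemma PSeries_linear_ode (a c : nat -> R) (M N t : R) :
  (forall n, Rabs (a n) <= M) -> (forall n, Rabs (c n) <= N) ->
  (forall n, PS_derive a n = PS_mult a (PS_derive c) n) -> Rabs t < 1 ->
  PSeries a t = a 0%nat * exp (PSeries c t - c 0%nat).
Proof.
  intros Ha Hc Hode Ht.
  assert (Hconst : PSeries a t * exp (- PSeries c t)
                   = PSeries a 0 * exp (- PSeries c 0)).
  { apply (is_derive_zero_const (fun s => PSeries a s * exp (- PSeries c s)) 1);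
      [|exact Ht].
    intros s Hs.
    pose proof (CV_radius_of_bounded a M s Ha Hs) as Ra.
    pose proof (CV_radius_of_bounded c N s Hc Hs) as Rc.
    pose proof (is_derive_PSeries a s Ra) as Da.
    pose proof (is_derive_PSeries c s Rc) as Dc.
    rewrite (PSeries_ext _ _ s Hode), PSeries_mult in Da;
      [|exact Ra|rewrite CV_radius_derive; exact Rc].
    auto_derive.
    - split; [eexists; exact Da|split; [eexists; exact Dc|exact I]].
    - rewrite (is_derive_unique (fun x : R => PSeries a x) _ _ Da).
      rewrite (is_derive_unique (fun x : R => PSeries c x) _ _ Dc).
      ring. }
  rewrite !PSeries_0 in Hconst.
  replace (PSeries c t - c 0%nat) with (- c 0%nat + PSeries c t) by ring.
  rewrite exp_plus, <- Rmult_assoc, <- Hconst, Rmult_assoc, <- exp_plus.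
  replace (- PSeries c t + PSeries c t) with 0 by ring.
  rewrite exp_0; ring.
Qed.

(* Taylor coefficients of the derivative of ln (1 + t/12) - ln (1 - 11 t/12). *)
Definition dlog_coef (n : nat) : R := / 12 * (- / 12) ^ n + 11 / 12 * (11 / 12) ^ n.

(* Taylor coefficients of (ln (1 + t/12) - ln (1 - 11 t/12)) / t. *)
Definition log_coef (n : nat) : R := dlog_coef n / INR (S n).

(* Taylor coefficients of (1 - 11 t/12) (ln (1 + t/12) - ln (1 - 11 t/12)) / t. *)
Definition exponent_coef : nat -> R :=
  PS_minus log_coef (PS_scal (11 / 12) (PS_incr_1 log_coef)).

(** The weights 1/12 and 11/12 add up to 1, and the positive term dominates the alternating one.
    Nonnegativity matters: a difference of two numbers in [0, 1] again has absolute value at most 1,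
    which is how the later bounds avoid a constant 2. *)
Lemma dlog_coef_bounds (n : nat) : 0 <= dlog_coef n <= 1.
Proof.
  unfold dlog_coef.
  assert (H1 : Rabs ((- / 12) ^ n) <= (11 / 12) ^ n).
  { rewrite <- RPow_abs, Rabs_Ropp, Rabs_pos_eq by lra.
    apply pow_incr; lra. }
  assert (H2 : (11 / 12) ^ n <= 1).
  { rewrite <- (pow1 n); apply pow_incr; lra. }
  apply Rabs_le_between in H1.
  lra.
Qed.

Lemma log_coef_bounds (n : nat) : 0 <= log_coef n <= 1.
Proof.
  unfold log_coef.
  pose proof (dlog_coef_bounds n) as [H0 H1].
  assert (Hn : 1 <= INR (S n)) by (apply (le_INR 1); lia).
  split; [apply Rdiv_le_0_compat; lra|].
  apply Rle_div_l; lra.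
Qed.

Lemma exponent_coef_0 : exponent_coef 0 = 1.
Proof.
  unfold exponent_coef, PS_minus, PS_opp, PS_plus, PS_scal, log_coef, dlog_coef.
  cbn; unfold plus, opp, scal, zero, mult; cbn; unfold mult; cbn; field.
Qed.

Lemma exponent_coef_S (n : nat) :
  exponent_coef (S n) = log_coef (S n) - 11 / 12 * log_coef n.
Proof. reflexivity. Qed.

Lemma exponent_coef_bound (n : nat) : Rabs (exponent_coef n) <= 1.
Proof.
  destruct n as [|n].
  - rewrite exponent_coef_0, Rabs_R1; lra.
  - rewrite exponent_coef_S.
    pose proof (log_coef_bounds n); pose proof (log_coef_bounds (S n)).
    apply Rabs_le; lra.
Qed.

Lemma PS_derive_exponent_coef_bound (n : nat) :
  Rabs (PS_derive exponent_coef n) <= 1.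
Proof.
  unfold PS_derive; rewrite exponent_coef_S; unfold log_coef.
  assert (Hn : 0 < INR (S n)) by apply lt_0_INR, Nat.lt_0_succ.
  (* The factor n + 1 from differentiation cancels the denominator of [log_coef n], leaving a
     difference of two numbers in [0, 1]. *)
  replace (INR (S n) * (dlog_coef (S n) / INR (S (S n))
             - 11 / 12 * (dlog_coef n / INR (S n))))
    with (INR (S n) / INR (S (S n)) * dlog_coef (S n) - 11 / 12 * dlog_coef n)
    by (rewrite (S_INR (S n)); field; lra).
  pose proof (dlog_coef_bounds n); pose proof (dlog_coef_bounds (S n)).
  assert (Hq : 0 <= INR (S n) / INR (S (S n)) <= 1).
  { rewrite (S_INR (S n)); split.
    - apply Rdiv_le_0_compat; lra.
    - apply Rle_div_l; lra. }
  apply Rabs_le; nra.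
Qed.

(** Both sides vanish at 0 and have the same derivative. The factor t is absorbed as an index shift
    of the series, so nothing is divided by t. *)
Lemma PSeries_log_coef (t : R) : Rabs t < 1 ->
  t * PSeries log_coef t = ln (1 + t / 12) - ln (1 - 11 / 12 * t).
Proof.
  intros Ht.
  assert (Hb : forall n, Rabs (PS_incr_1 log_coef n : R) <= 1).
  { intros [|n]; cbn.
    - unfold zero; cbn; rewrite Rabs_R0; lra.
    - pose proof (log_coef_bounds n); apply Rabs_le; lra. }
  rewrite <- PSeries_incr_1.
  apply Rminus_diag_uniq.
  transitivity (PSeries (PS_incr_1 log_coef) 0
                - (ln (1 + 0 / 12) - ln (1 - 11 / 12 * 0))).
  2: { rewrite PSeries_0; cbn; unfold zero; cbn.
       replace (1 + 0 / 12) with 1 by field.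
       replace (1 - 11 / 12 * 0) with 1 by field.
       ring. }
  apply (is_derive_zero_const (fun s => PSeries (PS_incr_1 log_coef) s
           - (ln (1 + s / 12) - ln (1 - 11 / 12 * s))) 1); [|exact Ht].
  intros s Hs.
  pose proof (is_derive_PSeries _ s (CV_radius_of_bounded _ 1 s Hb Hs)) as D.
  (* Differentiating the shifted series restores [dlog_coef], a combination of two geometric
     sequences with ratios -s/12 and 11 s/12. *)
  assert (Hgeom : PSeries (PS_derive (PS_incr_1 log_coef)) s
                  = / 12 * / (1 - - / 12 * s) + 11 / 12 * / (1 - 11 / 12 * s)).
  { unfold PSeries; apply is_series_unique.
    apply is_series_ext with
      (fun n => plus (scal (/ 12) ((- / 12 * s) ^ n))
                     (scal (11 / 12) ((11 / 12 * s) ^ n))).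
    - intros n; unfold plus, scal; cbn -[pow]; unfold mult; cbn -[pow].
      rewrite !Rpow_mult_distr.
      unfold PS_derive, PS_incr_1, log_coef, dlog_coef.
      field; apply not_0_INR; lia.
    - apply @is_series_plus; apply @is_series_scal; apply is_series_geom;
        apply Rabs_def2 in Hs; apply Rabs_def1; lra. }
  rewrite Hgeom in D.
  apply Rabs_def2 in Hs.
  auto_derive.
  - split; [eexists; exact D|split; lra].
  - rewrite (is_derive_unique (fun x : R => PSeries (PS_incr_1 log_coef) x) _ _ D).
    field; lra.
Qed.

Lemma PSeries_exponent_coef (t : R) : Rabs t < 1 ->
  PSeries exponent_coef t = (1 - 11 / 12 * t) * PSeries log_coef t.
Proof.
  intros Ht.
  assert (Hl : ex_pseries log_coef t).
  { apply CV_radius_inside, CV_radius_of_bounded with 1; [|exact Ht].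
    intros n; pose proof (log_coef_bounds n); apply Rabs_le; lra. }
  unfold exponent_coef.
  rewrite PSeries_minus, PSeries_scal, PSeries_incr_1; [ring|exact Hl|].
  apply ex_pseries_scal; [apply Rmult_comm|].
  apply ex_pseries_incr_1, Hl.
Qed.

Lemma d_sequence_rec (d : nat -> R) (n : nat) : is_d_sequence d ->
  PS_derive d n = PS_mult d (PS_derive exponent_coef) n.
Proof.
  intros [_ Hd].
  unfold PS_derive at 1, PS_mult.
  rewrite (Hd (S n)) by lia.
  rewrite <- Rmult_assoc.
  replace (INR (S n) * (1 / INR (S n))) with 1
    by (field; apply not_0_INR; lia).
  rewrite Rmult_1_l, <- sum_n_Reals.
  apply sum_n_ext_loc; intros k Hk; cbn [pred] in Hk.
  replace (S n - k)%nat with (S (n - k)) by lia.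
  generalize (n - k)%nat as p; intros p.
  replace (S p - 1)%nat with p by lia.
  (* With p = n - k, the first fraction of the recursion comes from - 11/12 [log_coef p] and the
     second, with its minus sign, from [log_coef (S p)]. *)
  unfold PS_derive; rewrite exponent_coef_S; unfold log_coef, dlog_coef.
  replace (- / 12) with (-1 * / 12) by lra; unfold Rdiv.
  rewrite !Rpow_mult_distr, !pow_inv, !Nat.add_1_r; cbn [pow].
  rewrite (S_INR (S p)).
  assert (Hp : 0 < INR (S p)) by apply lt_0_INR, Nat.lt_0_succ.
  assert (H12 : 12 ^ p <> 0) by (apply pow_nonzero; lra).
  apply Rminus_diag_uniq; field; repeat split; lra.
Qed.

Lemma d_sequence_bound (d : nat -> R) (n : nat) :
  is_d_sequence d -> Rabs (d n) <= 1.
Proof.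
  intros Hd.
  induction n as [[|n] IH] using (well_founded_induction Nat.lt_wf_0).
  - rewrite (proj1 Hd); apply Rabs_le; lra.
  - assert (Hn : 0 < INR (S n)) by apply lt_0_INR, Nat.lt_0_succ.
    pose proof (d_sequence_rec d n Hd) as Hrec.
    unfold PS_derive at 1 in Hrec.
    apply Rmult_le_reg_l with (INR (S n)); [exact Hn|].
    rewrite <- (Rabs_pos_eq (INR (S n))) at 1 by lra.
    rewrite <- Rabs_mult, Hrec; unfold PS_mult.
    eapply Rle_trans; [apply Rsum_abs|].
    (* The convolution has exactly n + 1 terms, each at most 1 in absolute value by induction, which
       matches the factor n + 1 on the left. *)
    rewrite <- (Rmult_comm 1), <- sum_cte.
    apply sum_Rle; intros k Hk.
    rewrite Rabs_mult, <- (Rmult_1_l 1) at 1.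
    apply Rmult_le_compat; try apply Rabs_pos.
    + apply IH; lia.
    + apply PS_derive_exponent_coef_bound.
Qed.

Theorem theorem2 (d : nat -> R) (hd : is_d_sequence d)
    (m : nat) (hm : (1 <= m)%nat) :
  ex_series (fun n : nat => d (S n) / (INR m + 11 / 12) ^ (S n)) /\
  (1 + 1 / INR m) ^ m =
    exp 1 * (1 - Series (fun n : nat => d (S n) / (INR m + 11 / 12) ^ (S n))).
Proof.
  assert (Hm : 1 <= INR m) by (apply (le_INR 1); lia).
  set (t := / (INR m + 11 / 12)).
  assert (Ht0 : 0 < t) by (apply Rinv_0_lt_compat; lra).
  assert (Htx : t * (INR m + 11 / 12) = 1) by (apply Rinv_l; lra).
  assert (Ht : Rabs t < 1) by (apply Rabs_def1; nra).
  assert (Hterm : forall n, d (S n) * t ^ S n = d (S n) / (INR m + 11 / 12) ^ S n).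
  { intros n; unfold t; rewrite pow_inv; reflexivity. }
  assert (Hex : ex_series (fun n => d n * t ^ n)).
  { apply ex_pseries_R, CV_radius_inside, CV_radius_of_bounded with 1; [|exact Ht].
    intros n; apply d_sequence_bound, hd. }
  split.
  - apply ex_series_ext with (1 := Hterm).
    apply (ex_series_incr_1 (fun n => d n * t ^ n)), Hex.
  - rewrite <- (Series_ext _ _ Hterm).
    assert (HS : PSeries d t = -1 + Series (fun n => d (S n) * t ^ S n)).
    { unfold PSeries; rewrite Series_incr_1 by exact Hex.
      rewrite (proj1 hd); cbn [pow]; ring. }
    rewrite (PSeries_linear_ode d exponent_coef 1 1 t) in HS;
      [|intros n; apply d_sequence_bound, hd|exact exponent_coef_bound
       |intros n; apply d_sequence_rec, hd|exact Ht].
    rewrite exponent_coef_0, (proj1 hd) in HS.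
    (* Since d_0 = -1, the bracket of the theorem is minus the full series, hence this
       exponential. *)
    replace (1 - Series (fun n => d (S n) * t ^ S n))
      with (exp (PSeries exponent_coef t - 1)) by lra.
    rewrite <- exp_plus.
    replace (1 + (PSeries exponent_coef t - 1)) with (PSeries exponent_coef t) by ring.
    rewrite PSeries_exponent_coef by exact Ht.
    (* The choice of t gives 1 - 11 t/12 = m t and 1 + t/12 = (m + 1) t. The exponent thus becomes m
       times the logarithm of (m + 1)/m. *)
    replace (1 - 11 / 12 * t) with (INR m * t) by lra.
    rewrite Rmult_assoc, PSeries_log_coef, <- ln_div by (exact Ht || nra).
    replace ((1 + t / 12) / (1 - 11 / 12 * t)) with (1 + 1 / INR m).
    + symmetry; apply Rpower_pow, Rplus_lt_0_compat; [lra|].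
      apply Rdiv_lt_0_compat; lra.
    + unfold t; field; lra.
Qed.
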